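(* For all integers $M\ge1$, $$0\le d_{s,M}-d_s\le\frac{2^s}{2^{M-1}},\qquad 0<s<1,$$ $$0\le d_s-d_{s,M}\le\frac{2^s}{2^{M-1}},\qquad s>1,$$ $$0\le d_s-d_{s,M}\le\frac{2^{(1-M)(s+1)}}{(\log2)(2^{s+1}-1)},\qquad -1<s<0.$$
   Context: For $x\in[1/2,1]$, the number $1/x$ has at least one (and at most two, one finite and one infinite) binary expansion of the form $\frac1x=\sum_j 2^{-k_j}$ with integers $0=k_1<k_2<\cdots$ (finitely or infinitely many terms). Put $\vartheta_j=x2^{-k_j}$, with $\vartheta_j=0$ for $j$ beyond the number of terms if the expansion is finite. For $s>-1$ define $$\mathcal H(x,s)=\sum_{n=1}^\infty\vartheta_n^{s+1}+2(2^s-1)\sum_{n=1}^\infty\sum_{j=n+1}^\infty\vartheta_n^s\vartheta_j,$$ where terms $\vartheta_n^s\vartheta_j$ with $\vartheta_n=0$ are $0$. This value does not depend on which of the (at most two) expansions is used, and $\mathcal H(\cdot,s)$ is continuous on $[1/2,1]$. Define $$d_s=\begin{cases}\min_{1/2\le x\le1}\mathcal H(x,s),&0<s<1,\\ \max_{1/2\le x\le1}\mathcal H(x,s),&-1<s<0\text{ or }s>1.\end{cases}$$ For every integer $M\ge1$ let $\mathcal P_M$ be the set of points $x_{M,n}=\frac{2^M}{2^M+2n+1}$, $n=0,1,\dots,2^{M-1}-1$, and define $$d_{s,M}=\begin{cases}\min_{x\in\mathcal P_M}\mathcal H(x,s),&0<s<1,\\ \max_{x\in\mathcal P_M}\mathcal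 H(x,s),&-1<s<0\text{ or }s>1.\end{cases}$$ *)

(* Defs.v *)
From mathcomp Require Import all_boot all_order all_algebra.
From mathcomp Require Import all_classical all_reals all_analysis.
Import Order.TTheory GRing.Theory Num.Theory numFieldNormedType.Exports.

Set Implicit Arguments.
Unset Strict Implicit.
Unset Printing Implicit Defensive.

Local Open Scope classical_set_scope.
Local Open Scope ring_scope.

(* The exponents of an expansion form a finite or infinite sequence, encoded
   as k : nat -> option nat, with k j = None beyond the last term.  Indices
   start at 0, so that k 0, k 1, .. stand for k_1, k_2, .. *)
Definition pow2_term (R : realType) (k : nat -> option nat) (j : nat) : R :=
  if k j is Some m then 2 ^- m else 0.

(* k 0 = Some 0, k is strictly increasing while it is defined, it stays None
   once it is None, and sum_j 2^(-k_j) = y. *)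
Definition binary_expansion (R : realType) (y : R) (k : nat -> option nat) :
    Prop :=
  [/\ k 0%N = Some 0%N,
      forall j m, k j.+1 = Some m -> exists2 m', k j = Some m' & (m' < m)%N
    & series (@pow2_term R k) @ \oo --> y].

Definition vartheta (R : realType) (x : R) (k : nat -> option nat) (j : nat)
    : R := x * pow2_term R k j.

(* As 0 `^ a = 0 for a != 0, the missing terms contribute 0 to the first sum
   when s > -1; they contribute 0 to the double sum for every s, because
   vartheta j = 0 for j > n as soon as vartheta n = 0.  All the series below
   converge when k is a binary expansion of 1 / x and s > -1. *)
Definition expansion_H (R : realType) (x s : R) (k : nat -> option nat) : R :=
  let th := vartheta x k in
  \big[+%R/0]_(0 <= n <oo) (th n `^ (s + 1)) +
  2 * (2 `^ s - 1) *
    \big[+%R/0]_(0 <= n <oo) \big[+%R/0]_(n.+1 <= j <oo) (th n `^ s * th j).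

(* The value of expansion_H on a binary expansion of 1 / x; it does not depend
   on the expansion. *)
Definition calH (R : realType) (x s : R) : R :=
  xget 0 [set h | exists2 k, binary_expansion x^-1 k & h = expansion_H x s k].

(* The least (resp. greatest) element of A, and 0 if there is none. *)
Definition set_min (R : realType) (A : set R) : R :=
  xget 0 [set m | A m /\ lbound A m].

Definition set_max (R : realType) (A : set R) : R :=
  xget 0 [set m | A m /\ ubound A m].

(* Only meant for -1 < s, s != 0, s != 1. *)
Definition extremum_H (R : realType) (D : set R) (s : R) : R :=
  if 0 < s < 1 then set_min [set calH x s | x in D]
  else set_max [set calH x s | x in D].

Definition d_ (R : realType) (s : R) : R :=
  extremum_H [set x | 2^-1 <= x <= 1] s.

Definition calP (R : realType) (M : nat) : set R :=
  [set 2 ^+ M / (2 ^+ M + n.*2.+1%:R) | n in [set n | (n < 2 ^ M.-1)%N]].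

Definition dM_ (R : realType) (s : R) (M : nat) : R := extremum_H (@calP R M) s.

(* Main.v *)
Require Import Defs.
From mathcomp Require Import all_boot all_order all_algebra.
From mathcomp Require Import all_classical all_reals all_analysis.
From mathcomp Require Import ring lra.
Import Order.TTheory GRing.Theory Num.Theory numFieldNormedType.Exports.
Local Open Scope classical_set_scope.
Local Open Scope ring_scope.

(** Write p = s + 1, q = 2 `^ (- p) and v = 1 / (2 * x), so that v runs through
    [1/2, 1] with x.  Prepending a binary digit to a number of [0, 1] changes
    the functional, up to the weight x `^ p, by an affine map of ratio q.
    Hence it equals v `^ (- p) * selfsim q v, where [selfsim q] is the function
    fixed by these affine maps.  It is explicit: v plus (q - 1/2) times the
    Takagi-Landsberg function sum_n q ^+ n * tent^(n+1) v.  Along any binary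
    expansion of 1 / x the functional is then a telescoping sum of increments
    of [selfsim q] ([expansion_HE]); this gives independence of the expansion
    and continuity, hence existence of the extrema, at once.

    The points of [calP R M] correspond to the midpoints of the dyadic cells of
    length 2 ^- M in [1/2, 1], so every v is within 2 ^- M.+1 of one of them,
    and the theorem reduces to a modulus of continuity for
    v `^ (- p) * selfsim q v.

    Iterating M times the functional equation of the Takagi-Landsberg function
    yields one estimate for all q ([selfsim_modulus]).  When s > 0, q < 1/2 and
    the Takagi part is 1-Lipschitz; so [selfsim q] is nondecreasing and
    2-Lipschitz, while the weight v `^ (- p) is decreasing: the two effects
    oppose each other, and each alone is at most 2 `^ p * (2 * |v - v'|)
    ([profile_lipschitz]).  When -1 < s < 0 the estimate at depth M bounds the
    oscillation by a multiple of q ^+ M, and the variation of the weight is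
    absorbed using p * ln 2 <= 2 `^ p - 1 ([profile_holder]). *)

(** * The tent map and the Takagi-Landsberg function *)

(** Truncated below at 0, so that all iterates stay in [0, 1] and the series
    below converges at every real number. *)
Definition tent {R : realType} (t : R) : R := Num.max 0 (1 - `|1 - 2 * t|).

Lemma tent_itv {R : realType} (t : R) : 0 <= tent t <= 1.
Proof.
rewrite /tent le_max lexx /= ge_max ler01 /=.
by rewrite gerBl.
Qed.

Lemma tent_left {R : realType} (t : R) : 0 <= t <= 2^-1 -> tent t = 2 * t.
Proof.
move=> /andP[t0 t1]; rewrite /tent ger0_norm; last lra.
by rewrite max_r; lra.
Qed.

Lemma tent_lipschitz {R : realType} (a b : R) :
  `|tent a - tent b| <= 2 * `|a - b|.
Proof.
have max0_lip (x y : R) : `|Num.max 0 x - Num.max 0 y| <= `|x - y|.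
  have [? ?] : x - y <= `|x - y| /\ y - x <= `|x - y|.
    by rewrite ler_norm -opprB -normrN ler_norm.
  rewrite ler_norml; have [?|?] := leP 0 x; have [?|?] := leP 0 y;
    by apply/andP; split; lra.
apply: le_trans (max0_lip _ _) _.
have -> : 1 - `|1 - 2 * a| - (1 - `|1 - 2 * b|) =
          `|1 - 2 * b| - `|1 - 2 * a| by ring.
have -> : 2 * `|a - b| = `|(1 - 2 * a) - (1 - 2 * b)| :> R.
  have -> : (1 - 2 * a) - (1 - 2 * b) = - (2 * (a - b)) by ring.
  by rewrite normrN normrM ger0_norm.
rewrite distrC.
exact: ler_dist_dist.
Qed.

(** The Takagi-Landsberg function: on [0, 1], the iterate n.+1 of the tent map
    at t is twice the distance from 2 ^+ n * t to the nearest integer. *)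
Definition takagi {R : realType} (q t : R) : R :=
  limn (series (fun n => q ^+ n * iter n.+1 tent t)).

Section takagi.
Context {R : realType} (q : R).
Hypotheses (q0 : 0 < q) (q1 : q < 1).

Lemma iterS_tent_itv n (t : R) : 0 <= iter n.+1 tent t <= 1.
Proof. exact: tent_itv. Qed.

Lemma geometric_series_le N : series (geometric 1 q) N <= (1 - q)^-1.
Proof.
rewrite geometric_seriesE ?lt_eqF//= mul1r ler_pdivrMr ?subr_gt0//.
by rewrite mulVf ?subr_eq0 ?gt_eqF// gerBl exprn_ge0 // ltW.
Qed.

Lemma takagi_cvg (t : R) :
  series (fun n => q ^+ n * iter n.+1 tent t) @ \oo --> takagi q t.
Proof.
apply: (@series_le_cvg _ _ (geometric 1 q)) => [n|n|n|].
- by have /andP[? ?] := iterS_tent_itv n t; rewrite mulr_ge0// exprn_ge0// ltW.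
- by rewrite /= mul1r exprn_ge0// ltW.
- have /andP[? ?] := iterS_tent_itv n t.
  by rewrite /= mul1r ler_piMr// exprn_ge0// ltW.
- by apply: is_cvg_geometric_series; rewrite ger0_norm ?ltW.
Qed.

Lemma takagi_itv (t : R) : 0 <= takagi q t <= (1 - q)^-1.
Proof.
have cvt := takagi_cvg t.
rewrite -(cvg_lim (@Rhausdorff R) cvt).
have cv : cvgn (series (fun n => q ^+ n * iter n.+1 tent t)).
  by apply/cvg_ex; eexists; exact: cvt.
apply/andP; split.
- apply: limr_ge => //; apply: nearW => N.
  apply: sumr_ge0 => n _.
  by have /andP[? ?] := iterS_tent_itv n t; rewrite mulr_ge0// exprn_ge0// ltW.
- apply: limr_le => //; apply: nearW => N.
  apply: le_trans (geometric_series_le N); apply: ler_sum => n _.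
  have /andP[? ?] := iterS_tent_itv n t.
  by rewrite /= mul1r ler_piMr// exprn_ge0// ltW.
Qed.

(** Splitting off the first term of the series leaves the same series at the
    image of t; symmetry, self-similarity and the modulus of continuity are
    read off this equation. *)
Lemma takagiE (t : R) : takagi q t = tent t + q * takagi q (tent t).
Proof.
rewrite {1}/takagi; apply: (cvg_lim (@Rhausdorff R)).
rewrite -cvg_shiftS /=.
rewrite (_ : (fun n => _) = (fun n => tent t +
    q * series (fun n => q ^+ n * iter n.+1 tent (tent t)) n)); last first.
  apply/funext => n; rewrite /series /= big_nat_recl//= expr0 mul1r; congr (_ + _).
  rewrite mulr_sumr; apply: eq_bigr => i _.
  by rewrite exprS mulrA -iterSr.
apply: cvgD; [exact: cvg_cst | apply: cvgMl_tmp; exact: takagi_cvg].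
Qed.

Lemma takagi_sym (t : R) : takagi q (1 - t) = takagi q t.
Proof.
rewrite takagiE [RHS]takagiE.
suff -> : tent (1 - t) = tent t by [].
rewrite /tent; congr (Num.max 0 (1 - _)).
by rewrite -normrN; congr `|_|; ring.
Qed.

Lemma takagi_half (t : R) : 0 <= t <= 1 ->
  takagi q (t / 2) = t + q * takagi q t.
Proof. by move=> t01; rewrite takagiE tent_left ?(mulrC t) ?mulVKf//; lra. Qed.

Lemma takagi0 : takagi q 0 = 0.
Proof.
have := takagi_half 0; rewrite mul0r lexx ler01 => /(_ isT).
move=> /eqP; rewrite add0r -subr_eq0 -{1}[takagi _ _]mul1r -mulrBl mulf_eq0.
by rewrite subr_eq0 gt_eqF//= => /eqP.
Qed.

(** Each use of [takagiE] costs a term of Lipschitz constant 2 and multiplies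
    the oscillation by q, while the tent map doubles distances; after M uses
    the oscillation is bounded by the supremum (1 - q)^-1.  Large M gives
    Lipschitz bounds when q < 1/2, and taking 2 ^- M of the order of
    [|a - b|] gives Hoelder bounds when q > 1/2. *)
Lemma takagi_modulus M (a b : R) :
  `|takagi q a - takagi q b| <=
    2 * (\sum_(n < M) (2 * q) ^+ n) * `|a - b| + q ^+ M / (1 - q).
Proof.
elim: M a b => [|M IH] a b.
  rewrite big_ord0 mulr0 mul0r add0r expr0 mul1r ler_norml.
  by have := takagi_itv a; have := takagi_itv b; move=> ? ?; apply/andP; split; lra.
rewrite (takagiE a) (takagiE b) opprD addrACA -mulrBr.
apply: le_trans (ler_normD _ _) _.
rewrite normrM (gtr0_norm q0).
have step := ler_wpM2l (ltW q0) (IH (tent a) (tent b)).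
have lip := tent_lipschitz a b.
rewrite big_ord_recl expr0 (eq_bigr (fun i : 'I_M => (2 * q) * (2 * q) ^+ i)).
  2: by move=> i _; rewrite /= /bump /= add1n exprS.
rewrite -mulr_sumr.
set S := \sum_(i < M) _ in step *.
have S0 : 0 <= S by apply: sumr_ge0 => i _; rewrite exprn_ge0// mulr_ge0// ltW.
have qS0 : 0 <= q * (2 * S) by apply: mulr_ge0; [exact: ltW|exact: mulr_ge0].
have lipS := ler_wpM2l qS0 lip.
apply: le_trans (lerD lip step) _.
rewrite exprS -(mulrA q (q ^+ M)); set Q := q ^+ M / _.
lra.
Qed.

End takagi.

(** * The self-similar function *)

(** The coefficient of [takagi] is the one that turns [takagiE] into the two
    affine equations [selfsim_half] and [selfsim_half1]: prepending a binary
    digit to v acts on [selfsim q v] by an affine map of ratio q. *)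
Definition selfsim {R : realType} (q v : R) : R := v + (q - 2^-1) * takagi q v.

Lemma exprn_small {R : realType} (q c e : R) :
  0 < q -> q < 1 -> 0 < e -> exists M, c * q ^+ M < e.
Proof.
move=> q0 q1 e0.
have cvq : (fun n => c * q ^+ n) @ \oo --> c * 0.
  by apply: cvgMl_tmp; apply: cvg_expr; rewrite gtr0_norm.
rewrite mulr0 in cvq.
have /cvgrPdist_lt /(_ e e0) [N _ /(_ N)] := cvq.
rewrite /= leqnn sub0r normrN => /(_ isT) h.
by exists N; apply: le_lt_trans (ler_norm _) h.
Qed.

Section selfsim.
Context {R : realType} (q : R).
Hypotheses (q0 : 0 < q) (q1 : q < 1).

Lemma selfsim0 : selfsim q 0 = 0.
Proof. by rewrite /selfsim takagi0// mulr0 addr0. Qed.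

Lemma selfsim_half (v : R) : 0 <= v <= 1 -> selfsim q (v / 2) = q * selfsim q v.
Proof. by move=> v01; rewrite /selfsim takagi_half//; field. Qed.

(** Here the tent map folds (1 + v) / 2 onto 2 - 2 * ((1 + v) / 2) = 1 - v, so
    the symmetry of [takagi] is what brings back v. *)
Lemma selfsim_half1 (v : R) : 0 <= v <= 1 ->
  selfsim q ((1 + v) / 2) = q + (1 - 2 * q) * v + q * selfsim q v.
Proof.
move=> v01; rewrite /selfsim -(takagi_sym _ q0 q1 ((1 + v) / 2)).
have -> : 1 - (1 + v) / 2 = (1 - v) / 2 by field.
by rewrite takagi_half ?takagi_sym//; [field | lra].
Qed.

Lemma selfsim_exp (v : R) m : 0 <= v <= 1 ->
  selfsim q (2 ^- m * v) = q ^+ m * selfsim q v.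
Proof.
move=> v01; elim: m => [|m IH]; first by rewrite !expr0 invr1 !mul1r.
have m2 : 2 ^- m <= 1 :> R by rewrite invf_le1 ?exprn_gt0// exprn_ege1// ler1n.
have m0 : 0 < 2 ^- m :> R by rewrite invr_gt0 exprn_gt0.
have -> : 2 ^- m.+1 * v = 2 ^- m * v / 2 by rewrite exprSr invfM mulrAC.
rewrite selfsim_half ?IH ?exprS ?mulrA//.
by case/andP: v01 => v0 v1; rewrite mulr_ge0 ?mulr_ile1// ltW.
Qed.

Lemma selfsim_itv (v : R) : q > 2^-1 -> 0 <= v <= 1 ->
  0 <= selfsim q v <= (2 * (1 - q))^-1.
Proof.
move=> qh /andP[v0 v1]; have /andP[t0 t1] := takagi_itv _ q0 q1 v.
have qh0 : 0 <= q - 2^-1 by lra.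
have := ler_wpM2l qh0 t1; have := mulr_ge0 qh0 t0; rewrite /selfsim => h0 h1.
have -> : (2 * (1 - q))^-1 = 1 + (q - 2^-1) / (1 - q).
  by field; rewrite subr_eq0 gt_eqF.
by apply/andP; split; lra.
Qed.

(** The geometric sum in [takagi_modulus] meets the coefficient q - 1/2, and
    their product telescopes to ((2 * q) ^+ M - 1) / 2. *)
Lemma selfsim_modulus M (a b : R) :
  `|(selfsim q a - a) - (selfsim q b - b)| <=
    `|(2 * q) ^+ M - 1| * `|a - b| + `|q - 2^-1| / (1 - q) * q ^+ M.
Proof.
have -> : selfsim q a - a - (selfsim q b - b) =
    (q - 2^-1) * (takagi q a - takagi q b) by rewrite /selfsim; ring.
rewrite normrM; apply: le_trans.
  by apply: ler_wpM2l (takagi_modulus _ q0 q1 M a b).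
set S := \sum_(i < M) _.
have S0 : 0 <= 2 * S.
  by rewrite mulr_ge0// sumr_ge0// => i _; rewrite exprn_ge0// mulr_ge0// ltW.
have -> : (2 * q) ^+ M - 1 = (q - 2^-1) * (2 * S) by rewrite subrX1 -/S; field.
rewrite normrM (ger0_norm S0) le_eqVlt; apply/orP; left; apply/eqP.
by field; rewrite subr_eq0 gt_eqF.
Qed.

Lemma selfsim_continuous : continuous (selfsim q).
Proof.
move=> t; apply/cvgrPdist_lt => e e0.
have e20 : 0 < e / 2 by rewrite divr_gt0.
have [M hM] := exprn_small _ (`|q - 2^-1| / (1 - q)) _ q0 q1 e20.
set K := 1 + `|(2 * q) ^+ M - 1|.
have K0 : 0 < K by rewrite ltr_pwDl.
have d0 : 0 < e / 2 / K by rewrite divr_gt0.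
near=> t'.
have close : `|t - t'| < e / 2 / K.
  by near: t'; exact: cvgr_dist_lt d0.
rewrite ltr_pdivlMr// /K mulrDr mulr1 mulrC in close.
have := selfsim_modulus M t t'.
set X := selfsim q t - t - _ => hX.
have -> : selfsim q t - selfsim q t' = (t - t') + X by rewrite /X; ring.
by apply: le_lt_trans (ler_normD _ _) _; lra.
Unshelve. all: by end_near. Qed.

(** The constant 1 is what makes [selfsim q] both nondecreasing and
    2-Lipschitz in [selfsim_slope]. *)
Lemma selfsim_lipschitz (a b : R) : q <= 2^-1 ->
  `|(selfsim q a - a) - (selfsim q b - b)| <= `|a - b|.
Proof.
move=> qh; have q21 : 2 * q <= 1 by lra.
have q20 : 0 <= 2 * q by rewrite mulr_ge0 ?ltW.
apply/ler_addgt0Pr => e e0.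
have [M hM] := exprn_small _ (`|q - 2^-1| / (1 - q)) _ q0 q1 e0.
apply: le_trans (selfsim_modulus M a b) _.
apply: lerD; last exact: ltW.
apply: ler_piMl => //.
have q2M0 : 0 <= (2 * q) ^+ M by exact: exprn_ge0.
have q2M1 : (2 * q) ^+ M <= 1 by exact: exprn_ile1.
clear hM; by rewrite ler_norml; apply/andP; split; lra.
Qed.

Lemma selfsim_slope (a b : R) : q <= 2^-1 -> a <= b ->
  0 <= selfsim q b - selfsim q a <= 2 * (b - a).
Proof.
move=> qh ab; have := selfsim_lipschitz b a qh.
rewrite (@ger0_norm _ (b - a)) ?subr_ge0// ler_norml => /andP[? ?].
by apply/andP; split; lra.
Qed.

End selfsim.

(** * Remainders of a binary expansion *)

Lemma pow2_term_ge0 {R : realType} k n : 0 <= pow2_term R k n.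
Proof. by rewrite /pow2_term; case: (k n) => // m; rewrite invr_ge0 exprn_ge0. Qed.

Lemma expn2V_powR {R : realType} (p : R) m :
  (2 ^- m) `^ p = (2 `^ (- p)) ^+ m.
Proof.
rewrite -powR_invn// -powRrM -powR_mulrn ?powR_ge0// -powRrM.
by congr (_ `^ _); ring.
Qed.

Section expansion.
Context {R : realType} (y : R) (k : nat -> option nat).
Hypothesis yk : binary_expansion y k.

Definition expansion_rest n : R := y - series (pow2_term R k) n.
Local Notation rest := expansion_rest.

Lemma expansion_rest0 : rest 0 = y.
Proof. by rewrite /rest /series /= big_geq// subr0. Qed.

Lemma expansion_restS n : rest n = pow2_term R k n + rest n.+1.
Proof. by rewrite /rest /series /= big_nat_recr//=; ring. Qed.

Lemma expansion_rest_cvg : rest @ \oo --> 0.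
Proof.
have [_ _ cv] := yk; rewrite -(subrr y).
by apply: cvgB => //; exact: cvg_cst.
Qed.

Lemma expansion_index_ge n m : k n = Some m -> (n <= m)%N.
Proof.
have [_ incr _] := yk; elim: n m => // n IH m /incr[m' /IH nm' m'm].
exact: leq_ltn_trans nm' m'm.
Qed.

Lemma expansion_none n i : k n = None -> k (n + i)%N = None.
Proof.
have [_ incr _] := yk; move=> kn; elim: i => [|i IH]; first by rewrite addn0.
rewrite addnS; case E: (k _) => [m|//].
by have [m'] := incr _ _ E; rewrite IH.
Qed.

(** The exponents increase strictly, so a block of terms is dominated by a
    geometric series of ratio 1/2. *)
Lemma expansion_block_le N n m : k n = Some m ->
  \sum_(i < N) pow2_term R k (n.+1 + i) <= 2 ^- m.
Proof.
have [_ incr _] := yk.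
elim: N n m => [|N IH] n m knm; first by rewrite big_ord0 invr_ge0 exprn_ge0.
case E: (k n.+1) => [m'|]; last first.
  rewrite big1 => [|i _]; first by rewrite invr_ge0 exprn_ge0.
  by rewrite /pow2_term expansion_none.
rewrite big_ord_recl addn0 {1}/pow2_term E.
rewrite (eq_bigr (fun i : 'I_N => pow2_term R k (n.+2 + i))); last first.
  by move=> i _; rewrite /= /bump /= add1n addnS.
have [m''] := incr _ _ E; rewrite knm => -[<-] mm'.
apply: le_trans (lerD (lexx _) (IH _ _ E)) _.
have -> : 2 ^- m' + 2 ^- m' = 2 * 2 ^- m' :> R by ring.
rewrite -(subnK mm') addnS exprS invfM mulrA divff// mul1r.
by rewrite ler_pV2 ?inE ?unitfE ?expf_neq0 ?exprn_gt0// ler_eXn2l ?ltr1n// leq_addl.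
Qed.

Lemma expansion_rest_ge0 n : 0 <= rest n.
Proof.
have [_ _ cv] := yk; rewrite /rest subr_ge0.
have <- := cvg_lim (@Rhausdorff R) cv.
apply: nondecreasing_cvgn_le; last by apply/cvg_ex; exists y.
by apply: nondecreasing_series => *; exact: pow2_term_ge0.
Qed.

Lemma expansion_rest_le n m : k n = Some m -> rest n.+1 <= 2 ^- m.
Proof.
move=> knm; have [_ _ cv] := yk.
rewrite /rest lerBlDl; have <- := cvg_lim (@Rhausdorff R) cv.
apply: limr_le; first by apply/cvg_ex; exists y.
near=> N; have nN : (n.+1 <= N)%N by near: N; exists n.+1.
rewrite -lerBlDl sub_series_geq// -[X in \sum_(X <= _ < _) _]add0n big_addn.
rewrite big_mkord; under eq_bigr do rewrite addnC.
exact: expansion_block_le.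
Unshelve. all: by end_near. Qed.

End expansion.

(** * The value of a binary expansion *)

Lemma powR2N_lt1 {R : realType} (p : R) : 0 < p -> 2 `^ (- p) < 1 :> R.
Proof.
move=> p0; rewrite -[ltRHS](powRr0 2) /powR gt_eqF// ltr_expR ltr_pM2r.
  by rewrite oppr_lt0.
by rewrite ln_gt0// ltr1n.
Qed.

Section expansion_value.
Context {R : realType} (x s : R) (k : nat -> option nat).
Hypotheses (x0 : 0 < x) (s1 : -1 < s) (s0 : s != 0).
Hypothesis xk : binary_expansion x^-1 k.

Let p := s + 1.
Let q := 2 `^ (- p).
Let th := vartheta x k.
Local Notation rest := (expansion_rest x^-1 k).

Let p0 : 0 < p. Proof. by rewrite /p -ltrBlDr sub0r. Qed.
Let q0 : 0 < q. Proof. exact: powR_gt0. Qed.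
Let q1 : q < 1. Proof. exact: powR2N_lt1. Qed.

Lemma vartheta_powR n :
  th n `^ p = if k n is Some m then x `^ p * q ^+ m else 0.
Proof.
rewrite /th /vartheta /pow2_term; case: (k n) => [m|].
  by rewrite powRM ?ltW ?invr_gt0 ?exprn_gt0// expn2V_powR.
by rewrite mulr0 powR0// gt_eqF.
Qed.

Lemma expansion_inner_cvg n :
  (fun N => \sum_(n.+1 <= j < N) th n `^ s * th j) @ \oo
    --> th n `^ s * (x * rest n.+1).
Proof.
have [_ _ cv] := xk.
under eq_fun do rewrite -mulr_sumr.
apply: cvgMl_tmp; rewrite /th /vartheta; under eq_fun do rewrite -mulr_sumr.
apply: cvgMl_tmp; apply: (@cvg_trans _
  ((fun N => series (pow2_term R k) N - series (pow2_term R k) n.+1) @ \oo)).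
  apply: near_eq_cvg; near=> N; rewrite sub_series_geq//.
  by near: N; exists n.+1.
by apply: cvgB => //; exact: cvg_cst.
Unshelve. all: by end_near. Qed.

(** Rescaled by the current term, the remainder at n is 1 + w with w in [0, 1],
    so [selfsim_half1] computes the increment of [selfsim] between consecutive
    remainders: up to the factor (2 * x) `^ p, it is the n-th term of the
    functional. *)
Lemma expansion_step n :
  th n `^ p + 2 * (2 `^ s - 1) * (th n `^ s * (x * rest n.+1)) =
  (2 * x) `^ p * (selfsim q (rest n / 2) - selfsim q (rest n.+1 / 2)).
Proof.
rewrite vartheta_powR; case E: (k n) => [m|]; last first.
  rewrite (expansion_restS _ _ n) /th /vartheta /pow2_term E mulr0 powR0//.
  by rewrite mul0r mulr0 !add0r subrr mulr0.
have m0 : 0 < 2 ^- m :> R by rewrite invr_gt0 exprn_gt0.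
set w := 2 ^+ m * rest n.+1.
have restE : rest n.+1 = 2 ^- m * w by rewrite /w mulKf// expf_neq0.
have w01 : 0 <= w <= 1.
  rewrite mulr_ge0 ?exprn_ge0 ?expansion_rest_ge0//=.
  by rewrite -ler_pdivlMl ?exprn_gt0// mulr1 expansion_rest_le.
have -> : rest n / 2 = 2 ^- m * ((1 + w) / 2).
  by rewrite expansion_restS restE /pow2_term E; ring.
have -> : rest n.+1 / 2 = 2 ^- m * (w / 2) by rewrite restE; ring.
rewrite !selfsim_exp ?selfsim_half1 ?selfsim_half//; [|lra..].
have -> : th n `^ s * (x * rest n.+1) = x `^ p * q ^+ m * w.
  rewrite restE /th /vartheta /pow2_term E powRM ?ltW//.
  rewrite /q -expn2V_powR /p !powRD ?gt_eqF ?implybT// !powRr1 ?ltW//.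
  by ring.
have -> : (2 * x) `^ p = q^-1 * x `^ p.
  by rewrite powRM ?ltW// /q powRN invrK.
have -> : 2 * (2 `^ s - 1) = q^-1 - 2.
  by rewrite /q powRN invrK /p powRD ?gt_eqF ?implybT// powRr1//; ring.
by field; rewrite gt_eqF.
Qed.

(** By [expansion_step] the series telescopes, and the remaining term tends to
    [selfsim q 0 = 0].  The right-hand side does not mention the expansion,
    which is why the value is independent of its choice. *)
Lemma expansion_HE : expansion_H x s k = (2 * x) `^ p * selfsim q ((2 * x)^-1).
Proof.
have b0 : 2 * (2 `^ s - 1) != 0 :> R.
  rewrite mulf_neq0// subr_eq0 powR_eq1 !negb_or s0 -leNgt ler0n !andbT.
  by rewrite (eqr_nat R 2 1).
set b := 2 * (2 `^ s - 1) in b0 *.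
set A := fun n => th n `^ p.
set B := fun n => th n `^ s * (x * rest n.+1).
have cvA : cvgn (series A).
  apply: (@series_le_cvg _ _ (geometric (x `^ p) q)) => [n|n|n|].
  - exact: powR_ge0.
  - by rewrite /= mulr_ge0 ?powR_ge0// exprn_ge0// ltW.
  - rewrite /A vartheta_powR /=; case E: (k n) => [m|]; last first.
      by rewrite mulr_ge0 ?powR_ge0// exprn_ge0// ltW.
    rewrite ler_wpM2l ?powR_ge0// ler_wiXn2l ?ltW//.
    exact: (expansion_index_ge _ _ xk _ _ E).
  - by apply: is_cvg_geometric_series; rewrite gtr0_norm.
have cvAB : (fun N => series A N + b * series B N) @ \oo -->
    (2 * x) `^ p * selfsim q ((2 * x)^-1).
  have -> : (fun N => series A N + b * series B N) = (fun N => (2 * x) `^ p *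
      (selfsim q (x^-1 / 2) - selfsim q (rest N / 2))).
    apply/funext => N; rewrite /series /= mulr_sumr -big_split /=.
    under eq_bigr do rewrite expansion_step.
    rewrite -mulr_sumr; congr (_ * _).
    under eq_bigr do rewrite -opprB.
    rewrite sumrN telescope_sumr// opprB expansion_rest0//.
  have -> : (2 * x)^-1 = x^-1 / 2 by rewrite invfM mulrC.
  have cv0 : (fun N => selfsim q (rest N / 2)) @ \oo --> (0 : R).
    rewrite -(selfsim0 q q0 q1).
    apply: (@continuous_cvg _ _ _ _ _ (fun N => rest N / 2)).
      exact: selfsim_continuous.
    rewrite -(mul0r (2^-1 : R)); apply: cvgMr_tmp.
    exact: expansion_rest_cvg.
  have := cvgB (cvg_cst (selfsim q (x^-1 / 2))) cv0.
  by rewrite subr0 => cvd; apply: cvgMl_tmp; exact: cvd.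
(* The second series converges because a combination of the two does, with a
   nonzero coefficient b: this is where s != 0 matters. *)
have cvB : cvgn (series B).
  have -> : series B = (fun N => b^-1 * (series A N + b * series B N - series A N)).
    by apply/funext => N; rewrite addrAC subrr add0r mulKf.
  apply/cvg_ex; eexists; apply: cvgMl_tmp; apply: cvgB; [exact: cvAB|exact: cvA].
have <- : limn (series A) + b * limn (series B) =
    (2 * x) `^ p * selfsim q ((2 * x)^-1).
  rewrite -(cvg_lim (@Rhausdorff R) cvAB); apply/esym.
  apply: (cvg_lim (@Rhausdorff R)).
  by apply: cvgD => //; apply: cvgMl_tmp.
rewrite /expansion_H; congr (_ + _ * _).
apply: (congr1 (fun f : nat -> R => limn f)); apply/funext => N.
apply: eq_bigr => n _.
exact: (cvg_lim (@Rhausdorff R) (expansion_inner_cvg n)).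
Qed.

End expansion_value.

(** * Existence of expansions and a closed form for the functional *)

(** The largest power of 1/2 strictly below r.  The strict inequality makes
    the greedy algorithm never stop, so it only produces infinite
    expansions. *)
Lemma greedy_digit {R : realType} (r : R) : 0 < r <= 1 ->
  exists k, 0 < r - 2 ^- k <= 2 ^- k.
Proof.
move=> /andP[r0 r1].
have ex : exists k, 2 ^- k < r.
  have h0 : 0 < 2^-1 :> R by rewrite invr_gt0.
  have h1 : 2^-1 < 1 :> R by rewrite invf_lt1// ltr1n.
  have [k] := exprn_small (2^-1) 1 r h0 h1 r0.
  by rewrite mul1r exprVn; exists k.
exists (ex_minn ex); case: ex_minnP => -[|k] kr kmin.
  by move: kr; rewrite expr0 invr1 ltNge r1.
rewrite subr_gt0 kr /= lerBlDr.
have : r <= 2 ^- k by rewrite leNgt; apply/negP => /kmin; rewrite ltnn.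
suff -> : 2 ^- k = 2 ^- k.+1 + 2 ^- k.+1 :> R by [].
by rewrite exprS invfM; field; rewrite expf_neq0.
Qed.

Lemma binary_expansion1 {R : realType} :
  binary_expansion (1 : R) (fun j => if j is 0%N then Some 0%N else None).
Proof.
split=> [//|//|].
rewrite -cvg_shiftS.
apply: (@cvg_trans _ ((fun=> 1 : R) @ \oo)); last exact: cvg_cst.
apply: near_eq_cvg; apply: nearW => n.
rewrite /series /= big_nat_recl//= /pow2_term expr0 invr1.
by rewrite big1// addr0.
Qed.

(** For y = 1 the leading term already exhausts y; otherwise the greedy digits
    of y - 1 give an infinite expansion. *)
Lemma binary_expansion_ex {R : realType} (y : R) : 1 <= y <= 2 ->
  exists k, binary_expansion y k.
Proof.
move=> /andP[]; rewrite le_eqVlt => /predU1P[<- _|y1 y2].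
  by eexists; exact: binary_expansion1.
pose digit (r : R) := xget 0%N [set k | 0 < r - 2 ^- k <= 2 ^- k].
have digitP (r : R) : 0 < r <= 1 -> 0 < r - 2 ^- digit r <= 2 ^- digit r.
  by move=> /greedy_digit/(xgetPex 0%N).
pose rem n := iter n (fun r => r - 2 ^- digit r) (y - 1).
pose k n := if n is n'.+1 then digit (rem n') else 0%N.
have le1 m : 2 ^- m <= 1 :> R.
  by rewrite invf_le1 ?exprn_gt0// exprn_ege1// ler1n.
have remP n : 0 < rem n <= 2 ^- k n.
  elim: n => [|n /andP[r0 r1]]; first by rewrite /= expr0 invr1; lra.
  by apply: digitP; rewrite r0 (le_trans r1).
have k_lt n : (k n < k n.+1)%N.
  have /andP[r0 r1] := remP n; have /andP[r0' _] := remP n.+1.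
  have lt2 : 2 ^- k n.+1 < 2 ^- k n :> R.
    by apply: lt_le_trans r1; rewrite -subr_gt0.
  rewrite ltnNge; apply/negP => kk; move: lt2; apply/negP; rewrite -leNgt.
  by rewrite lef_pV2 ?posrE ?exprn_gt0// ler_eXn2l ?ltr1n.
have k_ge n : (n <= k n)%N by elim: n => // n IH; exact: leq_ltn_trans (k_lt n).
exists (fun n => Some (k n)); split=> [//|j m [<-]|].
  by exists (k j); [|exact: k_lt].
rewrite -cvg_shiftS.
apply: (@cvg_trans _ ((fun n => y - rem n) @ \oo)).
  apply: near_eq_cvg; apply: nearW => n; rewrite /series /=; elim: n => [|n IH].
    by rewrite big_nat1 /pow2_term /= expr0 invr1 subKr.
  by rewrite big_nat_recr//= -IH /pow2_term /rem /=; ring.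
have rem0 : rem @ \oo --> (0 : R).
  apply: (@squeeze_cvgr _ _ _ _ (fun=> 0) (fun n => (2^-1) ^+ n)).
  - apply: nearW => n; have /andP[r0 r1] := remP n.
    rewrite ltW//= (le_trans r1)// exprVn.
    by rewrite lef_pV2 ?posrE ?exprn_gt0// ler_eXn2l ?ltr1n.
  - exact: cvg_cst.
  - by apply: cvg_expr; rewrite ger0_norm ?invr_ge0// invf_lt1// ltr1n.
by have := cvgB (cvg_cst y) rem0; rewrite subr0; apply.
Qed.

(** The functional in the variable v = 1 / (2 * x), which maps [1/2, 1] onto
    itself; there [selfsim] is only evaluated inside [0, 1]. *)
Definition profile {R : realType} (p v : R) : R :=
  v `^ (- p) * selfsim (2 `^ (- p)) v.

Lemma calHE {R : realType} (x s : R) : 2^-1 <= x <= 1 -> -1 < s -> s != 0 ->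
  calH x s = profile (s + 1) ((2 * x)^-1).
Proof.
move=> /andP[hx x1] s1 s0.
have x0 : 0 < x by lra.
have x20 : 0 <= 2 * x by lra.
have y12 : 1 <= x^-1 <= 2.
  by rewrite invf_ge1// x1 /= -[leRHS]invrK lef_pV2 ?posrE// invr_gt0.
have [k0 xk0] := binary_expansion_ex x^-1 y12.
have [k xk ->] : [set h | exists2 k, binary_expansion x^-1 k &
    h = expansion_H x s k] (calH x s).
  by apply: xgetPex; exists (expansion_H x s k0); exists k0.
rewrite expansion_HE// /profile; congr (_ * _).
by rewrite -powR_inv1// -powRrM mulrN mulN1r opprK.
Qed.

(** A Bernoulli-type bound valid for every exponent p >= 0, from
    ln a >= 1 - a^-1. *)
Lemma powR_ge {R : realType} (a p : R) : 0 < a -> 0 <= p ->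
  1 + p * (1 - a^-1) <= a `^ p.
Proof.
move=> a0 p0; rewrite /powR gt_eqF//; apply: le_trans (expR_ge1Dx _).
rewrite lerD2l ler_wpM2l//.
have := @le_ln1Dx _ (a^-1 - 1); rewrite subrKC.
rewrite lnV ?posrE// => h.
have : - ln a <= a^-1 - 1.
  by apply: h; rewrite ltrBrDl subrr invr_gt0.
lra.
Qed.

(** Factoring out the power at v leaves a difference of values of [selfsim] in
    which the weight is the power of a ratio, to be bounded by
    [ratio_powR_ge]. *)
Lemma profileB {R : realType} (p v v' : R) : 0 < v -> 0 < v' ->
  profile p v - profile p v' = v `^ (- p) *
    (selfsim (2 `^ (- p)) v - (v / v') `^ p * selfsim (2 `^ (- p)) v').
Proof.
move=> v0 v'0; rewrite /profile mulrBr; congr (_ - _).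
rewrite mulrA powRM ?ltW ?invr_gt0// mulrA -powRD ?(gt_eqF v0) ?implybT//.
by rewrite addNr powRr0 mul1r -powR_inv1 ?ltW// -powRrM mulN1r.
Qed.

Lemma powRN_half_le {R : realType} (p v : R) : 0 <= p -> 2^-1 <= v ->
  v `^ (- p) <= 2 `^ p.
Proof.
move=> p0 v2; have v0 : 0 < v by rewrite (lt_le_trans _ v2)// invr_gt0.
rewrite -mulN1r powRrM powR_inv1 ?(ltW v0)//.
apply: (ge0_ler_powR p0); rewrite ?nnegrE ?invr_ge0 ?(ltW v0)//.
by rewrite -[leRHS]invrK lef_pV2 ?posrE ?invr_gt0.
Qed.

Lemma selfsim1 {R : realType} (q : R) : 0 < q -> q < 1 -> selfsim q 1 = 1.
Proof.
move=> q0 q1; rewrite /selfsim -(takagi_sym _ q0 q1) subrr takagi0//.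
by rewrite mulr0 addr0.
Qed.

(** * Moduli of continuity of the profile *)

Lemma ratio_powR_ge {R : realType} (p v v' : R) : 0 < v -> 0 < v' -> 0 <= p ->
  1 - p * ((v' - v) / v) <= (v / v') `^ p.
Proof.
move=> v0 v'0 p0; apply: le_trans (powR_ge _ _ (divr_gt0 v0 v'0) p0).
rewrite invf_div mulrBl divff ?gt_eqF//.
by rewrite le_eqVlt; apply/orP; left; apply/eqP; ring.
Qed.

Lemma powR2_ge {R : realType} (p : R) : 0 < p -> p <= 2 `^ p.
Proof.
move=> p0; have h0 : 0 <= p / 2 by lra.
have h := powR_ge 2 (p / 2) (ltr0n R 2) h0.
have e : 2 `^ p = 2 `^ (p / 2) * 2 `^ (p / 2).
  rewrite -powRD ?(gt_eqF (ltr0n R 2)) ?implybT//.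
  by congr (_ `^ _); field.
rewrite e; set w := 2 `^ (p / 2) in h *.
have hw : 1 + p / 4 <= w by lra.
have p40 : 0 <= 1 + p / 4 by lra.
apply: le_trans (ler_pM p40 p40 hw hw).
by have := sqr_ge0 (1 - p / 4); rewrite expr2; lra.
Qed.

(** For v' < v the weight only helps, and the 2-Lipschitz bound on [selfsim]
    suffices.  For v <= v' monotonicity of [selfsim] reduces the difference to
    the variation of the weight, and one needs
    p * selfsim q v <= 2 * v * (2 * v) `^ p. *)
Lemma profile_lipschitz {R : realType} (p v v' : R) : 1 < p ->
  2^-1 <= v <= 1 -> 2^-1 <= v' <= 1 ->
  profile p v - profile p v' <= 2 `^ p * (2 * `|v - v'|).
Proof.
move=> p1 /andP[v2 v1] /andP[v'2 v'1].
have p0 : 0 < p by lra.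
have v0 : 0 < v by lra.
have v'0 : 0 < v' by lra.
have q0 : 0 < 2 `^ (- p) :> R by rewrite powR_gt0.
have qh : 2 `^ (- p) <= 2^-1 :> R.
  by rewrite -powR_inv1// ler_powR ?ler1n//; lra.
have q1 : 2 `^ (- p) < 1 :> R by lra.
have u0 : 0 < 2 `^ p :> R by rewrite powR_gt0.
have qu : 2 `^ (- p) * 2 `^ p = 1 :> R by rewrite powRN mulVf ?gt_eqF.
rewrite profileB//; set q := 2 `^ (- p) in q0 qh q1 qu *.
set r := (v / v') `^ p; have r_ge := ratio_powR_ge p v v' v0 v'0 (ltW p0).
rewrite -/r in r_ge.
have F0 w : 0 <= w -> 0 <= selfsim q w.
  by move=> w0; have := selfsim_slope q q0 q1 0 w qh w0; rewrite selfsim0//; lra.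
have c0 : 0 <= v `^ (- p) by exact: powR_ge0.
have [vv'|v'v] := leP v v'; last first.
  have slope := selfsim_slope q q0 q1 v' v qh (ltW v'v).
  have r1 : 1 <= r.
    apply: le_trans r_ge; rewrite lerBrDl gerDr mulr_ge0_le0 ?ltW//.
    by rewrite pmulr_llt0 ?invr_gt0// subr_lt0.
  have Fv'0 := F0 v' (ltW v'0).
  rewrite gtr0_norm ?subr_gt0//.
  have X : selfsim q v - r * selfsim q v' <= 2 * (v - v').
    by have := ler_wpM2r Fv'0 r1; lra.
  apply: le_trans (ler_wpM2l c0 X) _.
  by rewrite ler_wpM2r ?powRN_half_le ?(ltW p0)//; lra.
have /andP[slope _] := selfsim_slope q q0 q1 v v' qh vv'.
have Fv0 := F0 v (ltW v0).
have r0 : 0 <= r by exact: powR_ge0.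
rewrite ler0_norm ?subr_le0// opprB.
have X : selfsim q v - r * selfsim q v' <= p * ((v' - v) / v) * selfsim q v.
  have h1 : r * selfsim q v <= r * selfsim q v' by rewrite ler_wpM2l//; lra.
  by have := ler_wpM2r Fv0 r_ge; lra.
apply: le_trans (ler_wpM2l c0 X) _.
have [y1 y0] : 1 <= 2 * v /\ 0 < 2 * v by lra.
have y_ge := powR_ge (2 * v) p y0 (ltW p0).
have Fle : selfsim q v <= q + 2 * v - 1.
  have /andP[_] := selfsim_slope q q0 q1 2^-1 v qh v2.
  have -> : 2^-1 = 1 / 2 :> R by rewrite mul1r.
  by rewrite selfsim_half ?selfsim1 ?ler01 ?lexx//; lra.
have pq : p * q <= 1.
  by rewrite -qu mulrC ler_wpM2l ?powR2_ge// ltW.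
have pF : p * selfsim q v <= 2 * v * (2 * v) `^ p.
  apply: le_trans (ler_wpM2l (ltW p0) Fle) _.
  apply: le_trans (ler_wpM2l (ltW y0) y_ge).
  have -> : 2 * v * (1 + p * (1 - (2 * v)^-1)) = 2 * v + p * (2 * v - 1).
    by field; rewrite gt_eqF.
  lra.
have cu : v `^ (- p) * (2 * v) `^ p = 2 `^ p.
  rewrite powRM ?(ltW v0)// mulrCA -powRD ?(gt_eqF v0) ?implybT//.
  by rewrite addNr powRr0 mulr1.
have -> : v `^ (- p) * (p * ((v' - v) / v) * selfsim q v) =
    v `^ (- p) * (p * selfsim q v) * ((v' - v) / v) by ring.
have -> : 2 `^ p * (2 * (v' - v)) =
    v `^ (- p) * (2 * v * (2 * v) `^ p) * ((v' - v) / v).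
  by rewrite -cu; field; rewrite gt_eqF.
by rewrite ler_wpM2r ?divr_ge0 ?subr_ge0 ?(ltW v0)// ler_wpM2l.
Qed.

(** With Q = q ^+ M, [selfsim_modulus] at depth M bounds the difference of
    [selfsim] by a multiple of Q.  When v < v' the weight contributes a term
    proportional to p * |v - v'|, absorbed through
    p * ln 2 <= 2 `^ p - 1; this is the source of the factor ln 2 in the
    bound. *)
Lemma profile_holder {R : realType} (p v v' : R) M : 0 < p < 1 ->
  2^-1 <= v <= 1 -> 2^-1 <= v' <= 1 -> `|v - v'| <= 2 ^- M.+1 ->
  profile p v - profile p v' <=
    2 `^ p * (2 `^ (- p)) ^+ M / (ln 2 * (2 `^ p - 1)).
Proof.
move=> /andP[p0 p1] /andP[v2 v1] /andP[v'2 v'1] dM.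
have v0 : 0 < v by lra.
have v'0 : 0 < v' by lra.
have q0 : 0 < 2 `^ (- p) :> R by rewrite powR_gt0.
have q1 : 2 `^ (- p) < 1 :> R by exact: powR2N_lt1.
have qh : 2^-1 < 2 `^ (- p) :> R.
  rewrite -powR_inv1// /powR gt_eqF// ltr_expR ltr_pM2r; first lra.
  by rewrite ln_gt0// ltr1n.
have l0 : 0 < ln 2 :> R by rewrite ln_gt0// ltr1n.
have l1 : ln 2 <= 1 :> R.
  by have := @le_ln1Dx R 1; rewrite (_ : 1 + 1 = 2)//; apply; lra.
have u0 : 0 < 2 `^ p :> R by rewrite powR_gt0.
have uE : 2 `^ p = (2 `^ (- p))^-1 :> R by rewrite powRN invrK.
have pl : 1 + p * ln 2 <= 2 `^ p by rewrite /powR gt_eqF// expR_ge1Dx.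
have c0 : 0 <= v `^ (- p) by exact: powR_ge0.
have cu := powRN_half_le p v (ltW p0) v2.
rewrite profileB//.
have r_ge := ratio_powR_ge p v v' v0 v'0 (ltW p0).
set r := (v / v') `^ p in r_ge *.
rewrite uE in pl cu *; set q := 2 `^ (- p) in q0 qh q1 pl cu *.
have q'0 : 0 < 1 - q by lra.
have /andP[F'0 F'1] := selfsim_itv q q0 q1 v' qh ltac:(lra).
have modulus := selfsim_modulus q q0 q1 M v v'.
set F := selfsim q v in modulus *; set F' := selfsim q v' in F'0 F'1 modulus *.
set d := `|v - v'| in dM modulus *.
have d0 : 0 <= d by exact: normr_ge0.
move: modulus; rewrite exprMn; set Q := q ^+ M; set E := (2 : R) ^+ M.
have Q0 : 0 < Q by rewrite exprn_gt0.
have E0 : 0 < E by rewrite exprn_gt0.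
have T1 : 1 <= E * Q by rewrite -exprMn exprn_ege1//; lra.
have dE : E * d <= 2^-1.
  by rewrite -ler_pdivlMl// -invfM mulrC -exprS.
set g := (1 - q)^-1; have gq : g * (1 - q) = 1 by rewrite mulVf ?gt_eqF.
have g0 : 0 < g by rewrite invr_gt0.
have {}F'1 : F' <= g / 2 by rewrite mulrC -invfM.
rewrite (@ger0_norm _ (E * Q - 1)) ?subr_ge0// (@gtr0_norm _ (q - 2^-1)) ?subr_gt0//.
rewrite ler_norml => /andP[_ modulus].
pose L := (ln 2 : R)^-1.
have L0 : 0 < L by rewrite invr_gt0.
have L1 : 1 <= L by rewrite invf_ge1.
have lL : ln 2 * L = 1 by rewrite divff ?gt_eqF.
have Td : E * Q * d <= Q / 2.
  by rewrite mulrAC mulrC ler_wpM2l// ltW.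
(* Up to the factor 2 `^ p, which bounds v `^ (- p), this is the claim. *)
have bound : F - r * F' <= Q * q * L * g.
  have [vv'|v'v] := leP v v'; last first.
    have dv : d = v - v' by rewrite /d gtr0_norm ?subr_gt0.
    have r1 : 1 <= r.
      apply: le_trans r_ge; rewrite lerBrDl gerDr mulr_ge0_le0 ?(ltW p0)//.
      by rewrite ltW// pmulr_llt0 ?invr_gt0// subr_lt0.
    have h1 := ler_wpM2r F'0 r1.
    have h2 : F - F' <= Q / 2 + (q - 2^-1) * g * Q by lra.
    have h3 : Q / 2 + (q - 2^-1) * g * Q = Q * q * g / 2.
      have -> : Q / 2 = Q * (g * (1 - q)) / 2 by rewrite gq mulr1.
      by field.
    have Qqg : 0 <= Q * q * g by rewrite !mulr_ge0 ?ltW.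
    have h4 : Q * q * g <= Q * q * L * g.
      by rewrite (mulrAC _ L) ler_peMr.
    by clear T1 dE modulus; lra.
  have dv : d = v' - v by rewrite /d ler0_norm ?subr_le0// opprB.
  have pg : p * g <= 2 * L.
    have h1 : p <= L * (q^-1 - 1).
      by rewrite mulrC ler_pdivlMr//; lra.
    have h2 : p * g <= L * q^-1.
      apply: le_trans (ler_wpM2r (ltW g0) h1) _.
      rewrite le_eqVlt; apply/orP; left; apply/eqP; rewrite /g.
      by field; rewrite !gt_eqF.
    have h3 : q^-1 <= 2 by rewrite -[leRHS]invrK lef_pV2 ?posrE ?invr_gt0// ltW.
    by apply: le_trans h2 _; rewrite mulrC ler_wpM2r// ltW.
  have dv0 : 0 <= d / v by rewrite mulr_ge0 ?invr_ge0 ?(ltW v0).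
  have h1 : F - r * F' <= F - F' + p * (d / v) * F'.
    by have := ler_wpM2r F'0 r_ge; rewrite -dv; lra.
  have h2 : p * (d / v) * F' <= 2 * L * d.
    have v'2' : v^-1 <= 2 by rewrite -[leRHS]invrK lef_pV2 ?posrE ?invr_gt0.
    have h3 : d / v <= d * 2 by rewrite ler_wpM2l.
    apply: (@le_trans _ _ (p * (d * 2) * (g / 2))).
      apply: ler_pM => //; first by rewrite mulr_ge0 ?(ltW p0).
      by rewrite ler_wpM2l ?(ltW p0).
    have -> : p * (d * 2) * (g / 2) = p * g * d by field.
    by rewrite ler_wpM2r.
  have h3 : d <= Q / 2.
    by apply: le_trans Td; rewrite ler_peMl.
  have h4 : (L - 1) * d <= (L - 1) * (Q / 2) by rewrite ler_wpM2l// subr_ge0.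
  have h5 : F - r * F' <= Q * (L - 2^-1 + (q - 2^-1) * g).
    by clear T1 dE r_ge pl; lra.
  apply: le_trans h5 _; rewrite -!mulrA ler_wpM2l// ?(ltW Q0)//.
  have -> : L - 2^-1 = (L - 2^-1) * (g * (1 - q)) by rewrite gq mulr1.
  have -> : (L - 2^-1) * (g * (1 - q)) + (q - 2^-1) * g =
      g * ((L - 2^-1) * (1 - q) + (q - 2^-1)) by ring.
  have -> : q * (L * g) = g * (q * L) by ring.
  rewrite ler_wpM2l ?(ltW g0)//.
  have : (L - 1) * (1 - 2 * q) <= 0 by rewrite mulr_ge0_le0//; lra.
  lra.
have -> : q^-1 * Q / (ln 2 * (q^-1 - 1)) = q^-1 * (Q * q * L * g).
  by rewrite /L /g; field; rewrite !gt_eqF//= subr_gt0.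
have B0 : 0 <= Q * q * L * g by rewrite !mulr_ge0 ?ltW.
apply: le_trans (ler_wpM2l c0 bound) _.
by rewrite ler_wpM2r.
Qed.

(** * Extrema over the interval and over dyadic midpoints *)

Lemma profile_continuous {R : realType} (p : R) : 0 < p ->
  {within `[2^-1, 1], continuous (profile p)}.
Proof.
move=> p0; apply: continuous_in_subspaceT => v.
rewrite inE/= in_itv/= => /andP[v2 _].
have v0 : 0 < v by rewrite (lt_le_trans _ v2)// invr_gt0.
have cpow : {for v, continuous (fun w : R => w `^ (- p))}.
  apply: differentiable_continuous; apply/derivable1_diffP.
  by apply: derivable_powR; rewrite in_itv/= andbT.
apply: cvgM; first exact: cpow.
by apply: selfsim_continuous; [rewrite powR_gt0 | exact: powR2N_lt1].
Qed.

Lemma set_max_image {R : realType} (D : set R) (f : R -> R) c : D c ->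
  (forall x, D x -> f x <= f c) -> set_max [set f x | x in D] = f c.
Proof.
move=> Dc fc; apply: xget_unique => [|m /= [[x Dx <-]]].
  by split; [exists c | move=> _ [x Dx <-]; exact: fc].
by move=> /(_ _ (ex_intro2 _ _ c Dc erefl)) cx; apply/eqP; rewrite eq_le fc.
Qed.

Lemma set_min_image {R : realType} (D : set R) (f : R -> R) c : D c ->
  (forall x, D x -> f c <= f x) -> set_min [set f x | x in D] = f c.
Proof.
move=> Dc fc; apply: xget_unique => [|m /= [[x Dx <-]]].
  by split; [exists c | move=> _ [x Dx <-]; exact: fc].
by move=> /(_ _ (ex_intro2 _ _ c Dc erefl)) cx; apply/eqP; rewrite eq_le fc// andbT.
Qed.

Lemma finite_argmax {R : realType} (h : nat -> R) K : (0 < K)%N ->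
  exists2 n, (n < K)%N & forall m, (m < K)%N -> h m <= h n.
Proof.
case: K => // K _; elim: K => [|K [n nK hn]].
  by exists 0%N => // m; rewrite ltnS leqn0 => /eqP ->.
have [hK|hK] := leP (h n) (h K.+1).
  exists K.+1 => // m; rewrite ltnS leq_eqVlt => /predU1P[->//|mK].
  exact: le_trans (hn _ mK) hK.
exists n; first exact: ltnW.
move=> m; rewrite ltnS leq_eqVlt => /predU1P[->|]; [exact: ltW | exact: hn].
Qed.

Lemma finite_cell {R : realType} (t : R) K : (0 < K)%N -> 0 <= t <= K%:R ->
  exists2 n, (n < K)%N & n%:R <= t <= n.+1%:R.
Proof.
case: K => // K _; elim: K => [|K IH] /andP[t0 tK].
  by exists 0%N => //; rewrite t0.
have [tK'|tK'] := leP t K.+1%:R.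
  by have [|n nK tn] := IH; [rewrite t0 | exists n => //; exact: ltnW].
by exists K.+1 => //; rewrite (ltW tK').
Qed.

Lemma halfV_itv {R : realType} (x : R) : 2^-1 <= x <= 1 ->
  2^-1 <= (2 * x)^-1 <= 1.
Proof.
move=> /andP[x2 x1]; have x0 : 0 < 2 * x by lra.
by rewrite invf_le1// lef_pV2 ?posrE//; apply/andP; split; lra.
Qed.

Lemma halfVK {R : realType} (x : R) : (2 * (2 * x)^-1)^-1 = x.
Proof. by rewrite invfM invrK mulKf. Qed.

Lemma calP_itv {R : realType} (M : nat) (x : R) : (1 <= M)%N -> @calP R M x ->
  2^-1 <= x <= 1.
Proof.
move=> M1 [n /= nM <-].
have P0 : 0 < 2 ^+ M :> R by rewrite exprn_gt0.
have N0 : 0 <= n.*2.+1%:R :> R by [].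
have NP : n.*2.+1%:R <= 2 ^+ M :> R.
  rewrite -natrX ler_nat -(prednK M1) expnS mul2n ltn_double; exact: nM.
rewrite ler_pdivrMr ?ler_pdivlMr ?ltr_pwDl//.
by apply/andP; split; lra.
Qed.

(** In the variable 1 / (2 * x) the points of [calP] are the midpoints of the
    dyadic cells of length 2 ^- M in [1/2, 1]. *)
Lemma calP_dense {R : realType} (M : nat) (x : R) : (1 <= M)%N ->
  2^-1 <= x <= 1 -> exists2 x', @calP R M x' &
    `|(2 * x)^-1 - (2 * x')^-1| <= 2 ^- M.+1.
Proof.
case: M => // M _ /halfV_itv; set v := (2 * x)^-1 => /andP[v2 v1].
have P0 : 0 < 2 ^+ M :> R by rewrite exprn_gt0.
have [|n nM] := finite_cell (2 * 2 ^+ M * v - 2 ^+ M) (2 ^ M) (expn_gt0 2 M).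
  rewrite natrX; apply/andP; split.
    by rewrite subr_ge0 mulrAC ler_peMl ?(ltW P0)//; lra.
  by have := ler_wpM2l (ltW P0) v1; lra.
move=> /andP[nv vn].
exists (2 ^+ M.+1 / (2 ^+ M.+1 + n.*2.+1%:R)); first by exists n.
rewrite [(2 * (_ / _))^-1]invfM invf_div -muln2 -[(n * 2).+1]addn1 natrD natrM.
rewrite -[_.+1]addn1 natrD in vn.
rewrite ler_norml !exprS; set P := 2 ^+ M in P0 nv vn *.
have -> : 2^-1 * ((2 * P + (n%:R * 2 + 1%:R)) / (2 * P)) =
   (4 * P)^-1 * (2 * P + 2 * n%:R + 1) by field; rewrite gt_eqF.
have -> : v = (4 * P)^-1 * (4 * P * v) by field; rewrite gt_eqF.
have -> : (2 * (2 * P))^-1 = (4 * P)^-1 * 1 by field; rewrite gt_eqF.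
have I0 : 0 <= (4 * P)^-1 by rewrite invr_ge0 mulr_ge0// ltW.
rewrite -mulrBr -mulrN.
by apply/andP; split; apply: ler_wpM2l => //; lra.
Qed.

Section extrema.
Context {R : realType} (s : R) (M : nat).
Hypotheses (s1 : -1 < s) (s0 : s != 0) (M1 : (1 <= M)%N).

Let D : set R := [set x | 2^-1 <= x <= 1].
Let p0 : 0 < s + 1. Proof. by rewrite -ltrBlDr sub0r. Qed.

Lemma calH_argmax : exists2 c, D c & forall x, D x -> calH x s <= calH c s.
Proof.
have h : (2^-1 : R) <= 1 by rewrite invf_le1// ler1n.
have [v vD vmax] := EVT_max h (profile_continuous _ p0).
move: vD; rewrite in_itv /= => vD.
exists ((2 * v)^-1); first exact: halfV_itv.
move=> x Dx; rewrite !calHE ?halfV_itv// halfVK.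
by apply: vmax; rewrite in_itv /= halfV_itv.
Qed.

Lemma calH_argmin : exists2 c, D c & forall x, D x -> calH c s <= calH x s.
Proof.
have h : (2^-1 : R) <= 1 by rewrite invf_le1// ler1n.
have [v vD vmax] := EVT_min h (profile_continuous _ p0).
move: vD; rewrite in_itv /= => vD.
exists ((2 * v)^-1); first exact: halfV_itv.
move=> x Dx; rewrite !calHE ?halfV_itv// halfVK.
by apply: vmax; rewrite in_itv /= halfV_itv.
Qed.

Lemma calP_argmax (f : R -> R) :
  exists2 c, @calP R M c & forall x, @calP R M x -> f x <= f c.
Proof.
have [n nM hn] := finite_argmax
  (fun n => f (2 ^+ M / (2 ^+ M + n.*2.+1%:R))) (2 ^ M.-1) (expn_gt0 2 _).
exists (2 ^+ M / (2 ^+ M + n.*2.+1%:R)); first by exists n.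
by move=> _ [m /= mM <-]; exact: hn.
Qed.

Section closeness.
Variable e : R.
Hypothesis He : forall v v', 2^-1 <= v <= 1 -> 2^-1 <= v' <= 1 ->
  `|v - v'| <= 2 ^- M.+1 -> profile (s + 1) v - profile (s + 1) v' <= e.

(** A one-sided modulus is enough: the maximum over the interval is compared
    with the value at the midpoint of a cell containing a maximiser. *)
Lemma set_max_close :
  0 <= set_max [set calH x s | x in D] - set_max [set calH x s | x in @calP R M]
    <= e.
Proof.
have [c Dc cmax] := calH_argmax.
have [c' Pc' c'max] := calP_argmax (fun x => calH x s).
rewrite (set_max_image _ _ _ Dc cmax) (set_max_image _ _ _ Pc' c'max).
rewrite subr_ge0 cmax ?calP_itv//=; last exact: calP_itv Pc'.
have [x Px cx] := calP_dense M c M1 Dc.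
apply: (@le_trans _ _ (calH c s - calH x s)); first by rewrite lerB// c'max.
have Dx := calP_itv _ _ M1 Px.
by rewrite !calHE//; apply: He => //; exact: halfV_itv.
Qed.

Lemma set_min_close :
  0 <= set_min [set calH x s | x in @calP R M] - set_min [set calH x s | x in D]
    <= e.
Proof.
have [c Dc cmin] := calH_argmin.
have [c' Pc' c'max] := calP_argmax (fun x => - calH x s).
have c'min x : @calP R M x -> calH c' s <= calH x s.
  by move=> Px; rewrite -lerN2 c'max.
rewrite (set_min_image _ _ _ Dc cmin) (set_min_image _ _ _ Pc' c'min).
rewrite subr_ge0 cmin ?calP_itv//=; last exact: calP_itv Pc'.
have [x Px cx] := calP_dense M c M1 Dc.
apply: (@le_trans _ _ (calH x s - calH c s)); first by rewrite lerB// c'min.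
have Dx := calP_itv _ _ M1 Px.
by rewrite !calHE//; apply: He; rewrite ?halfV_itv// distrC.
Qed.

End closeness.
End extrema.

Lemma profile_dyadic_lipschitz {R : realType} (M : nat) (s v v' : R) :
  (1 <= M)%N -> 0 < s ->
  2^-1 <= v <= 1 -> 2^-1 <= v' <= 1 -> `|v - v'| <= 2 ^- M.+1 ->
  profile (s + 1) v - profile (s + 1) v' <= 2 `^ s / 2 ^+ M.-1.
Proof.
case: M => // M _ s0 vI v'I dM.
have s1 : 1 < s + 1 by rewrite ltrDr.
apply: le_trans (profile_lipschitz _ _ _ s1 vI v'I) _.
apply: le_trans.
  by apply: ler_wpM2l; [exact: powR_ge0 | apply: ler_wpM2l dM].
rewrite powRD ?(gt_eqF (ltr0n R 2)) ?implybT// powRr1// !exprS /=.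
by rewrite le_eqVlt; apply/orP; left; apply/eqP; field; rewrite expf_neq0.
Qed.

Theorem theorem1p5 (R : realType) (M : nat) (hM : (1 <= M)%N) :
  [/\ forall s : R, 0 < s < 1 ->
        0 <= dM_ s M - d_ s <= 2 `^ s / 2 ^+ M.-1,
      forall s : R, 1 < s ->
        0 <= d_ s - dM_ s M <= 2 `^ s / 2 ^+ M.-1
    & forall s : R, -1 < s < 0 ->
        0 <= d_ s - dM_ s M
          <= 2 `^ ((1 - M%:R) * (s + 1)) / (ln 2 * (2 `^ (s + 1) - 1))].
Proof.
rewrite /dM_ /d_ /extremum_H; split=> s.
- move=> /andP[s0 s1]; rewrite s0 s1 /=.
  apply: set_min_close => //; [lra | by rewrite gt_eqF|].
  by move=> v v'; exact: profile_dyadic_lipschitz.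
- move=> s1; have s0 : 0 < s by lra.
  rewrite s0 (lt_gtF s1) /=.
  apply: set_max_close => //; [lra | by rewrite gt_eqF|].
  by move=> v v'; exact: profile_dyadic_lipschitz.
- move=> /andP[s1 s0]; rewrite (lt_gtF s0) /=.
  apply: set_max_close => //; first by rewrite lt_eqF.
  move=> v v' vI v'I dM.
  have p01 : 0 < s + 1 < 1 by apply/andP; split; lra.
  apply: le_trans (profile_holder _ _ _ _ p01 vI v'I dM) _.
  rewrite -powR_mulrn ?powR_ge0// -powRrM -powRD ?(gt_eqF (ltr0n R 2)) ?implybT//.
  suff -> : s + 1 + - (s + 1) * M%:R = (1 - M%:R) * (s + 1) by exact: lexx.
  by ring.
Qed.
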